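(* Let $t_0\in\mathbb{R}$, let $b,k:[t_0,\infty)\to\mathbb{R}$ be continuous functions with $b(t)>0$ for all $t\ge t_0$ and such that $\frac1b+k$ is differentiable on $[t_0,\infty)$. Suppose that there is a constant $M\in\mathbb{R}$ (possibly negative) such that for all $t\ge t_0$ $$\frac1{b(t)}+k(t)\ge M$$ and $$\frac{d}{dt}\, e^{\frac1{b(t)}+k(t)} \le -\frac{\bigl(e^{\frac1{b(t)}+k(t)}-k(t)\bigr)^2}{2b(t)}.$$ Then the zero solution of $u''(t)+b(t)u'(t)+k(t)u(t)=0$ on $[t_0,\infty)$ is stable.
   Context: The zero solution of the second-order equation is called stable if for each $\epsilon>0$ there exists $\delta=\delta(\epsilon,t_0)>0$ such that every solution $u$ on $[t_0,\infty)$ with $u(t_0)^2+u'(t_0)^2<\delta^2$ satisfies $u(t)^2+u'(t)^2<\epsilon^2$ for all $t\ge t_0$. The initial time $t_0$ is fixed. *)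

(* Defs.v *)
From Stdlib Require Import Reals.
Open Scope R_scope.

(* Functions on [t0, oo) are represented by total functions R -> R whose values
   on (-oo, t0) are never used: limits, continuity and derivatives are taken
   relative to the domain (Stdlib's [continue_in] and [D_in]), so that they are
   one-sided at t0. *)
Definition half_line (t0 : R) : R -> Prop := fun t => t0 <= t.

Definition continuous_on (D : R -> Prop) (f : R -> R) : Prop :=
  forall t, D t -> continue_in f D t.

Definition derivative_on (D : R -> Prop) (f f' : R -> R) : Prop :=
  forall t, D t -> D_in f f' D t.

Definition differentiable_on (D : R -> Prop) (f : R -> R) : Prop :=
  exists f', derivative_on D f f'.

(* u solves u'' + b u' + k u = 0 on [t0, oo), and u' is its derivative there. *)
Definition is_solution (t0 : R) (b k u u' : R -> R) : Prop :=
  derivative_on (half_line t0) u u' /\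
  exists u'' : R -> R,
    derivative_on (half_line t0) u' u'' /\
    forall t, t0 <= t -> u'' t + b t * u' t + k t * u t = 0.

Definition zero_solution_stable (t0 : R) (b k : R -> R) : Prop :=
  forall eps, 0 < eps -> exists delta, 0 < delta /\
    forall u u' : R -> R, is_solution t0 b k u u' ->
      u t0 ^ 2 + u' t0 ^ 2 < delta ^ 2 ->
      forall t, t0 <= t -> u t ^ 2 + u' t ^ 2 < eps ^ 2.

(* Main.v *)
From Coquelicot Require Import Coquelicot.
From Stdlib Require Import Lra.
Require Import Defs.
From Stdlib Require Import Reals.
Open Scope R_scope.

(** The proof is Lyapunov's direct method.  Write [psi = exp (1/b + k)] and take
    [V = psi u^2 + u'^2].  Along a solution
      [V' = psi' u^2 + 2 (psi - k) u u' - 2 b u'^2],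
    a quadratic form in [(u, u')].  The assumed bound on [psi'] says exactly that
    its discriminant is nonpositive; completing the square gives
      [V' <= - ((psi - k) u - 2 b u')^2 / (2 b) <= 0]
    ([lyapunov_form_nonpos]), so [V] is nonincreasing
    ([nonincreasing_on_half_line]).  Since [psi >= exp M > 0], the energy [V t]
    is at least [min (exp M) 1] times [u^2 + u'^2], uniformly in [t];
    the value [V t0] is at most [max (psi t0) 1] times the same sum at [t0].
    Comparing the two bounds gives stability. *)

(** A mean value theorem for two-sided derivatives needs a function continuous
    on both sides of [t0]; clamping the argument below at [t0] supplies
    one, because [Rmax t0] is 1-Lipschitz. *)
Lemma continuity_clamp (t0 : R) (f : R -> R) :
  continuous_on (half_line t0) f ->
  forall t, continuity_pt (fun x => f (Rmax t0 x)) t.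
Proof.
intros hf t e he.
destruct (hf (Rmax t0 t) (Rmax_l t0 t) e he) as [d [hd H]].
exists d; split; [exact hd|].
intros x [_ hx]. simpl in *. unfold Rdist in *.
destruct (Req_dec (Rmax t0 t) (Rmax t0 x)) as [eq|ne].
- rewrite <- eq, Rminus_diag, Rabs_R0. exact he.
- apply H. split.
  + split; [exact (Rmax_l t0 x) | exact ne].
  + revert hx. unfold Rmax, Rabs.
    destruct (Rle_dec t0 x), (Rle_dec t0 t);
      repeat destruct Rcase_abs; lra.
Qed.

Lemma is_derive_clamp (t0 t : R) (f f' : R -> R) :
  t0 < t -> D_in f f' (half_line t0) t ->
  is_derive (fun x => f (Rmax t0 x)) t (f' t).
Proof.
intros ht hf. apply is_derive_Reals. intros e he.
destruct (hf e he) as [d [hd H]].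
assert (hm : 0 < Rmin d (t - t0)) by (apply Rmin_glb_lt; lra).
exists (mkposreal _ hm). intros h hn hlt. simpl in *.
assert (h1 := Rmin_l d (t - t0)). assert (h2 := Rmin_r d (t - t0)).
assert (h3 : - h <= Rabs h) by (rewrite <- Rabs_Ropp; apply Rle_abs).
rewrite !Rmax_right by lra.
specialize (H (t + h)). unfold Rdist in H.
replace (t + h - t) with h in H by ring.
apply H. split; [split|].
- unfold half_line; lra.
- lra.
- lra.
Qed.

Lemma derivative_on_continuous (D : R -> Prop) (f f' : R -> R) :
  derivative_on D f f' -> continuous_on D f.
Proof. intros hf t ht. exact (cont_deriv f f' D t (hf t ht)). Qed.

Lemma nonincreasing_on_half_line (t0 : R) (f f' : R -> R) :
  derivative_on (half_line t0) f f' ->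
  (forall t, t0 <= t -> f' t <= 0) ->
  forall t, t0 <= t -> f t <= f t0.
Proof.
intros hf hneg t ht.
destruct (MVT_gen (fun x => f (Rmax t0 x)) t0 t f') as [c [hc eq]].
- intros x [hx _]. rewrite Rmin_left in hx by exact ht.
  apply is_derive_clamp; [exact hx|]. apply hf. unfold half_line; lra.
- intros x _. apply continuity_clamp.
  exact (derivative_on_continuous _ _ _ hf).
- rewrite Rmin_left in hc by exact ht.
  rewrite (Rmax_right t0 t ht), (Rmax_left t0 t0 (Rle_refl t0)) in eq.
  assert (h := hneg c (proj1 hc)). nra.
Qed.

Lemma lyapunov_form_nonpos (b k p p' x y : R) :
  0 < b -> p' <= - ((p - k) ^ 2 / (2 * b)) ->
  p' * x ^ 2 + 2 * (p - k) * x * y - 2 * b * y ^ 2 <= 0.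
Proof.
intros hb hp.
assert (hsq : - ((p - k) ^ 2 / (2 * b)) * x ^ 2
              + 2 * (p - k) * x * y - 2 * b * y ^ 2
              = - (((p - k) * x - 2 * b * y) ^ 2 / (2 * b))) by (field; lra).
assert (hq : 0 <= ((p - k) * x - 2 * b * y) ^ 2 / (2 * b))
  by (apply Rdiv_le_0_compat; [apply pow2_ge_0 | lra]).
assert (hx := pow2_ge_0 x). nra.
Qed.

(** Substituting [u'' = - b u' - k u] into the derivative of [p u^2 + u'^2]
    turns it into the quadratic form of [lyapunov_form_nonpos], for any weight
    [p]. *)
Lemma energy_nonincreasing (t0 : R) (b k p p' u u' : R -> R) :
  (forall t, t0 <= t -> 0 < b t) ->
  derivative_on (half_line t0) p p' ->
  (forall t, t0 <= t -> p' t <= - ((p t - k t) ^ 2 / (2 * b t))) ->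
  is_solution t0 b k u u' ->
  forall t, t0 <= t ->
    p t * u t ^ 2 + u' t ^ 2 <= p t0 * u t0 ^ 2 + u' t0 ^ 2.
Proof.
intros hb hp hineq [hu [u'' [hu' eq]]] t ht.
assert (H : p t * (u t * u t) + u' t * u' t
            <= p t0 * (u t0 * u t0) + u' t0 * u' t0); [|lra].
apply (nonincreasing_on_half_line t0
  (fun s => p s * (u s * u s) + u' s * u' s)
  (fun s => (p' s * (u s * u s) + p s * (u' s * u s + u s * u' s))
            + (u'' s * u' s + u' s * u'' s))); [| |exact ht].
- intros s hs.
  apply (Dadd _ (fun x => p' x * (u x * u x)
                          + p x * (u' x * u x + u x * u' x))
                (fun x => u'' x * u' x + u' x * u'' x)
                (fun x => p x * (u x * u x)) (fun x => u' x * u' x)).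
  + apply (Dmult _ p' (fun x => u' x * u x + u x * u' x)
                   p (fun x => u x * u x)); [exact (hp s hs)|].
    apply Dmult; exact (hu s hs).
  + apply Dmult; exact (hu' s hs).
- intros s hs.
  assert (h := lyapunov_form_nonpos (b s) (k s) (p s) (p' s) (u s) (u' s)
                 (hb s hs) (hineq s hs)).
  replace (u'' s) with (- b s * u' s - k s * u s)
    by (specialize (eq s hs); lra).
  lra.
Qed.

Theorem theorem2p1 (t0 : R) (b k : R -> R)
  (hb : continuous_on (half_line t0) b)
  (hk : continuous_on (half_line t0) k)
  (hb_pos : forall t, t0 <= t -> 0 < b t)
  (hdiff : differentiable_on (half_line t0) (fun t => 1 / b t + k t))
  (M : R)
  (hM : forall t, t0 <= t -> M <= 1 / b t + k t)
  (E' : R -> R)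
  (hE' : derivative_on (half_line t0) (fun t => exp (1 / b t + k t)) E')
  (hineq : forall t, t0 <= t ->
     E' t <= - ((exp (1 / b t + k t) - k t) ^ 2 / (2 * b t))) :
  zero_solution_stable t0 b k.
Proof.
set (psi := fun t => exp (1 / b t + k t)) in *.
assert (hpsi : forall t, t0 <= t -> exp M <= psi t).
{ intros t ht. unfold psi. destruct (hM t ht) as [h|h].
  - left. now apply exp_increasing.
  - right. now rewrite h. }
set (m := Rmin (exp M) 1). set (K := Rmax (psi t0) 1).
assert (hm : 0 < m) by (apply Rmin_glb_lt; [apply exp_pos | lra]).
assert (hm1 : m <= 1) by apply Rmin_r.
assert (hmM : m <= exp M) by apply Rmin_l.
assert (hK1 : 1 <= K) by apply Rmax_r.
assert (hKpsi : psi t0 <= K) by apply Rmax_l.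
intros eps heps.
(* Only [K * delta^2 <= m * eps^2] is needed; the ratio [m / K] serves in place
   of its square root, because [m / K <= 1]. *)
set (c := m / K).
assert (hc : 0 < c) by (apply Rdiv_lt_0_compat; lra).
assert (hcK : K * c = m) by (unfold c; field; lra).
assert (hc1 : c <= 1) by nra.
exists (c * eps). split; [now apply Rmult_lt_0_compat|].
intros u u' hsol hinit t ht.
assert (hV := energy_nonincreasing t0 b k psi E' u u'
                hb_pos hE' hineq hsol t ht).
assert (hlow : m * (u t ^ 2 + u' t ^ 2) <= psi t * u t ^ 2 + u' t ^ 2).
{ assert (h := hpsi t ht).
  assert (h1 := pow2_ge_0 (u t)). assert (h2 := pow2_ge_0 (u' t)). nra. }
assert (hup : psi t0 * u t0 ^ 2 + u' t0 ^ 2 <= K * (u t0 ^ 2 + u' t0 ^ 2)).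
{ assert (h1 := pow2_ge_0 (u t0)). assert (h2 := pow2_ge_0 (u' t0)). nra. }
assert (hdelta : K * (u t0 ^ 2 + u' t0 ^ 2) < K * (c * eps) ^ 2)
  by (apply Rmult_lt_compat_l; lra).
assert (hfin : K * (c * eps) ^ 2 <= m * eps ^ 2).
{ replace (K * (c * eps) ^ 2) with (m * eps ^ 2 * c)
    by (rewrite <- hcK; ring).
  assert (h : 0 <= m * eps ^ 2)
    by (apply Rmult_le_pos; [lra | apply pow2_ge_0]).
  nra. }
apply Rmult_lt_reg_l with m; lra.
Qed.
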